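(* Let $p\ge2$, $k\in\mathbb N$, and consider the model $Y=B_0+\mathbf W^\top\mathbf B$ with $\mathbf W=(W_1,\dots,W_{p-1})^\top$, where $\mathbf A=(A_1,\dots,A_p)^\top=(B_0,\mathbf B^\top)^\top$ is independent of $\mathbf W$ and has finite absolute moments up to order $k$. Suppose that the support of $\mathbf W$ contains $p$ points $\mathbf w_1,\dots,\mathbf w_p\in\mathbb R^{p-1}$ in general position such that for each $j\in\{1,\dots,k\}$ and all (not necessarily distinct) $i_1,\dots,i_j\in\{1,\dots,p\}$ the vector $(\mathbf w_{i_1}+\dots+\mathbf w_{i_j})/j$ is also in the support of $\mathbf W$. Then the mixed moments of $\mathbf A$ up to order $k$ are identified, i.e. all $\mathbb E[A_1^{k_1}\cdots A_p^{k_p}]$ with $k_1,\dots,k_p\in\mathbb N_0$ and $k_1+\dots+k_p\le k$ are identified.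
   Context: Points $\mathbf w_1,\dots,\mathbf w_p\in\mathbb R^{p-1}$ are in general position if $\sum_{i=1}^p\alpha_i\mathbf w_i=\mathbf 0$ with $\alpha_i\in\mathbb R$, $\sum_{i=1}^p\alpha_i=0$ implies $\alpha_1=\dots=\alpha_p=0$ (affine independence). The support of $\mathbf W$ is the smallest closed set of probability one. By independence, the conditional moments of the response are $\mathbb E[Y^m\mid\mathbf W=\mathbf w]=\mathbb E\big[((1,\mathbf w^\top)\mathbf A)^m\big]$. With the law of $\mathbf W$ fixed, a moment of $\mathbf A$ is identified (from the conditional moments of $Y$ given $\mathbf W$) if, whenever two random coefficient vectors $\mathbf A,\mathbf A'$, independent of $\mathbf W$ and with finite absolute moments up to order $k$, satisfy $\mathbb E\big[((1,\mathbf w^\top)\mathbf A)^m\big]=\mathbb E\big[((1,\mathbf w^\top)\mathbf A')^m\big]$ for all $\mathbf w\in\operatorname{supp}(\mathbf W)$ and all $m\in\{1,\dots,k\}$, that moment is the same for $\mathbf A$ and $\mathbf A'$. *)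

(* Defs.v *)
From HB Require Import structures.
From mathcomp Require Import all_boot all_order all_algebra.
From mathcomp Require Import all_classical all_reals all_analysis.

Set Implicit Arguments.
Unset Strict Implicit.
Unset Printing Implicit Defensive.

Import Order.TTheory GRing.Theory Num.Theory.
Import numFieldNormedType.Exports.

Local Open Scope classical_set_scope.
Local Open Scope ring_scope.

(* Real column vectors of length n with the Borel sigma-algebra. *)
Notation borel_cV R n := (g_sigma_algebraType (@open 'cV[R]_n)).

(* R^n being second countable, the intersection of all closed sets of
   probability one is itself of probability one, so it is the smallest one. *)
Definition topological_support (R : realType) (n : nat)
    (mu : probability (borel_cV R n) R) : set 'cV[R]_n :=
  \bigcap_(C in [set C : set 'cV[R]_n | closed C /\ mu C = 1%E]) C.

Definition general_position (R : realType) (n p : nat) (w : 'I_p -> 'cV[R]_n) :=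
  forall alpha : 'I_p -> R,
    \sum_(i < p) alpha i *: w i = 0 -> \sum_(i < p) alpha i = 0 ->
    forall i, alpha i = 0.

Definition independent (R : realType) d (T : measurableType d)
    (P : probability T R) d1 (T1 : measurableType d1) d2 (T2 : measurableType d2)
    (X : {RV P >-> T1}) (Y : {RV P >-> T2}) :=
  forall (C : set T1) (D : set T2), measurable C -> measurable D ->
    P (X @^-1` C `&` Y @^-1` D) = (P (X @^-1` C) * P (Y @^-1` D))%E.

(* (1, w^T) a, where a stacks the intercept b0 on top of the slopes b *)
Definition response (R : realType) (n : nat)
    (w : 'cV[R]_n) (a : 'cV[R]_(1 + n)) : R :=
  (row_mx 1%:M w^T *m a) 0 0.

Lemma response_col_mx (R : realType) (n : nat) (w b : 'cV[R]_n) (b0 : R) :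
  response w (col_mx b0%:M b) = b0 + (w^T *m b) 0 0.
Proof. by rewrite /response mul_row_col mul1mx !mxE eqxx. Qed.

Section random_coefficients.
Context (R : realType) (n : nat) d (T : measurableType d) (P : probability T R).
Implicit Type A : {RV P >-> borel_cV R (1 + n)}.

(* The norm on column vectors is the library's maximum norm; the condition does
   not depend on the choice of the norm. *)
Definition finite_absolute_moments (k : nat) A :=
  forall m : nat, (m <= k)%N ->
    ('E_P[(fun omega => `|A omega : 'cV[R]_(1 + n)| ^+ m)%R] < +oo)%E.

(* E[Y^m | W = w] when Y = (1, W^T) A with A independent of W. *)
Definition conditional_moment A (m : nat) (w : 'cV[R]_n) : \bar R :=
  'E_P[(fun omega => response w (A omega) ^+ m)%R]%E.

Definition mixed_moment A (kappa : 'I_(1 + n) -> nat) : \bar R :=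
  'E_P[(fun omega =>
    \prod_(i < 1 + n) (A omega : 'cV[R]_(1 + n)) i 0 ^+ kappa i)%R]%E.

Definition random_coefficient_model (mu : probability (borel_cV R n) R)
    (k : nat) (W : {RV P >-> borel_cV R n}) A :=
  [/\ forall C : set (borel_cV R n), measurable C -> distribution P W C = mu C,
      independent W A
    & finite_absolute_moments k A].

End random_coefficients.

(* mu is the fixed law of the covariate vector; the two coefficient vectors
   may be defined on different probability spaces. *)
Definition moment_identified (R : realType) (n : nat)
    (mu : probability (borel_cV R n) R) (k : nat) (kappa : 'I_(1 + n) -> nat) :=
  forall (d : measure_display) (T : measurableType d) (P : probability T R)
    (W : {RV P >-> borel_cV R n}) (A : {RV P >-> borel_cV R (1 + n)})
    (d' : measure_display) (T' : measurableType d') (P' : probability T' R)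
    (W' : {RV P' >-> borel_cV R n}) (A' : {RV P' >-> borel_cV R (1 + n)}),
  random_coefficient_model mu k W A ->
  random_coefficient_model mu k W' A' ->
  (forall w, topological_support mu w -> forall m : nat, (1 <= m <= k)%N ->
     conditional_moment A m w = conditional_moment A' m w) ->
  mixed_moment A kappa = mixed_moment A' kappa.

(* Main.v *)
Require Import Defs.
From HB Require Import structures.
From mathcomp Require Import all_boot all_order all_algebra.
From mathcomp Require Import all_classical all_reals all_analysis.
From mathcomp Require Import measurable_realfun.

Set Implicit Arguments.
Unset Strict Implicit.
Unset Printing Implicit Defensive.

Import Order.TTheory GRing.Theory Num.Theory.
Import numFieldNormedType.Exports.
Local Open Scope classical_set_scope.
Local Open Scope ring_scope.

(** Write x_i = (1, w_i^T), so that the response at w_i is the linear form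
    L_i(a) = x_i a.  The argument has two algebraic steps, each made
    probabilistic by taking expectations of finite linear combinations.

    Polarization.  In a commutative ring m! X_1 ... X_m is the sum over the
    sets S of indices of (-1)^(m - |S|) (sum of the X_l with l in S)^m
    ([polarization]).  Take X_l = L_(i_l)(A).  Since the first entry of every
    x_i is 1, the sum of the L_(i_l) over S is |S| times the response at the
    average of the w_(i_l) over S ([sum_design_row]), and this average is in
    the support.  Hence the expectation of each product of at most k of the
    forms L_i(A) is determined by the conditional moments of the response
    ([same_design_product]).  This is where all j-point averages are needed,
    for every j up to the order of the moment.

    Change of basis.  Affine independence of the w_i says that the x_i form a
    basis of the row space ([general_position_span]), so each coordinate of A
    is a linear combination of the L_i(A).  Expanding a monomial in the
    coordinates gives a linear combination of products of as many forms, whose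
    expectations are already determined ([same_mixed_moment]).

    All these expectations are finite because a product of m linear forms in A
    is bounded by a constant times the m-th power of the norm of A
    ([integrable_prod_form]). *)

(** * Polarization *)

(** Expand the m-th power of each partial sum over all maps f of the index set
    into itself.  The coefficient of the product of the [x (f l)] is the
    alternating sum over the sets S that contain the image of f; it factors
    over the indices j as a product of 1 - [j not in the image].  So only the
    permutations survive, and each of the m! permutations contributes the full
    product. *)
Lemma polarization (R : comNzRingType) (m : nat) (x : 'I_m -> R) :
  \sum_(S : {set 'I_m}) (-1) ^+ #|~: S|%SET * (\sum_(l in S) x l) ^+ m =
  m`!%:R * \prod_l x l.
Proof.
have expand (S : {set 'I_m}) :
    (-1) ^+ #|~: S|%SET * (\sum_(l in S) x l) ^+ m =
    \sum_(f : {ffun 'I_m -> 'I_m})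
      (\prod_j (if j \in S then 1 else - (j \notin codom f)%:R)) *
      \prod_l x (f l).
  have -> : (\sum_(l in S) x l) ^+ m =
      \sum_(f : {ffun 'I_m -> 'I_m}) [forall l, f l \in S]%:R * \prod_l x (f l).
    rewrite big_mkcond /= -[X in _ ^+ X = _](card_ord m) -prodr_const.
    rewrite bigA_distr_bigA; apply: eq_bigr => f _ /=.
    case: (boolP [forall l, f l \in S]) => [/forallP fS|].
      by rewrite mul1r; apply: eq_bigr => l _; rewrite fS.
    rewrite negb_forall mul0r => /existsP[l lS].
    by rewrite (bigD1 l) //= (negbTE lS) mul0r.
  rewrite big_distrr; apply: eq_bigr => f _ /=; rewrite mulrA; congr (_ * _).
  case: (boolP [forall l, f l \in S]) => [/forallP fS|].
    rewrite mulr1 -prodr_const big_mkcond /=; apply: eq_bigr => j _.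
    rewrite finset.in_setC; case: ifPn; case: ifPn => // jS _.
    suff -> : j \notin codom f by [].
    by apply: contra jS => /codomP[l ->].
  rewrite negb_forall mulr0 => /existsP[l lS].
  by rewrite (bigD1 (f l)) //= (negbTE lS) codom_f /= oppr0 mul0r.
rewrite (eq_bigr _ (fun S _ => expand S)) exchange_big /=.
(* The sum over S of a product of two-way choices is a product of sums. *)
under eq_bigr => f _.
  rewrite -big_distrl /= -(bigA_distr _ (+%R) (fun=> 1)).
  over.
transitivity (\sum_(f : {ffun 'I_m -> 'I_m} | injectiveb f) \prod_l x l).
  rewrite [RHS]big_mkcond; apply: eq_bigr => f _.
  case: ifPn => [/injectiveP fi|].
    rewrite big1 => [|j _]; last by rewrite -[j](f_invF fi) codom_f /= subr0.
    by rewrite mul1r [RHS](reindex_inj fi).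
  (* A self-map of a finite set that is not injective misses some j. *)
  move=> fNi; suff [j jN] : exists j, j \notin codom f.
    by rewrite (bigD1 j) //= jN subrr !mul0r.
  apply/existsP; apply: contraR fNi; rewrite negb_exists => /forallP fS.
  apply/injectiveP => i j; apply: (@image_injP _ _ f predT _) => //.
  by apply/eqP/eq_card => l; rewrite inE -/(codom f); apply: negbNE.
rewrite sumr_const -[LHS]mulr_natl; congr (_%:R * _).
have := card_inj_ffuns 'I_m 'I_m; rewrite !card_ord ffactnn => <-.
by apply: eq_card => f; rewrite inE.
Qed.

(** * Linear forms and their integrability *)

Section linear_forms.
Context (R : realType) (n : nat).
Implicit Types (x : 'rV[R]_n) (a : 'cV[R]_n).

Definition form x a : R := (x *m a) 0 0.

Lemma formE x a : form x a = \sum_j x 0 j * a j 0.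
Proof. by rewrite /form mxE. Qed.

Lemma form_sum (I : finType) (S : {set I}) (x : I -> 'rV[R]_n) a :
  form (\sum_(i in S) x i) a = \sum_(i in S) form (x i) a.
Proof. by rewrite /form mulmx_suml summxE. Qed.

Lemma formZ (c : R) x a : form (c *: x) a = c * form x a.
Proof. by rewrite /form -scalemxAl mxE. Qed.

Lemma le_norm_form x a : `|form x a| <= (\sum_j `|x 0 j|) * `|a|.
Proof.
rewrite formE mulr_suml; apply: le_trans (ler_norm_sum _ _ _) _.
apply: ler_sum => j _; rewrite normrM ler_wpM2l//.
rewrite [leRHS]mx_normrE.
by rewrite (le_bigmax _ (fun ij : 'I_n * 'I_1 => `|a ij.1 ij.2|) (j, 0)).
Qed.

End linear_forms.

Section integrability.
Context (R : realType) (n : nat) d (T : measurableType d) (P : probability T R).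
Implicit Type A : {RV P >-> borel_cV R n}.

(** The coefficient vector is measurable for the sigma-algebra generated by the
    open sets of vectors, so it is enough to pull back open intervals. *)
Lemma measurable_continuous_comp A (f : 'cV[R]_n -> R) :
  continuous f -> measurable_fun setT (fun omega => f (A omega)).
Proof.
move=> cf; apply: (measurability _ (RGenOpens.measurableE R)).
move=> _ [_ [u [v ->]] <-].
apply: (@measurable_funP _ _ _ _ setT A measurableT (f @^-1` `]u, v[)).
apply: sub_sigma_algebra; apply: open_comp => [a _|]; last exact: interval_open.
exact: cf.
Qed.

Lemma measurable_form A (x : 'rV[R]_n) :
  measurable_fun setT (fun omega => form x (A omega)).
Proof.
rewrite (_ : (fun _ => _) =
    fun omega => \sum_j x 0 j * (A omega : 'cV[R]_n) j 0); last first.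
  by apply/funext => omega; rewrite formE.
apply: measurable_sum => j; apply: measurable_funM => //.
apply: (@measurable_continuous_comp A (fun a => a j 0)).
exact: coord_continuous.
Qed.

(** Each form is at most a constant times the norm, so a product of m of them is
    dominated by a multiple of the m-th power of the norm. *)
Lemma integrable_prod_form A (m : nat) (x : 'I_m -> 'rV[R]_n) :
  ('E_P[(fun omega => `|A omega : 'cV[R]_n| ^+ m)%R] < +oo)%E ->
  (fun omega => \prod_l form (x l) (A omega)) \in Lfun P 1.
Proof.
rewrite unlock => AmP; apply/Lfun1_integrable.
pose C := \prod_l \sum_j `|x l 0 j|.
have mA : measurable_fun setT (fun omega => `|A omega : 'cV[R]_n| ^+ m).
  apply: measurable_funX.
  apply: (@measurable_continuous_comp A (fun a => `|a|)).
  exact: norm_continuous.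
apply: (@le_integrable _ _ _ _ _ _ _
  (fun omega => (C%:E * (`|A omega : 'cV[R]_n| ^+ m)%:E)%E)) => //.
- apply/measurable_EFinP; apply: measurable_prod => l _; exact: measurable_form.
- move=> omega _ /=; rewrite lee_fin normr_prod.
  rewrite [leRHS]ger0_norm; last first.
    by rewrite mulr_ge0 ?exprn_ge0 // prodr_ge0 // => l _; rewrite sumr_ge0.
  rewrite -[in X in _ * X](card_ord m) -prodr_const -big_split /=.
  by apply: ler_prod => l _; rewrite normr_ge0 le_norm_form.
- apply: integrableZl => //; apply/integrableP; split.
    exact/measurable_EFinP.
  under eq_integral do rewrite gee0_abs ?lee_fin ?exprn_ge0 //.
  exact: AmP.
Qed.

Lemma expectation_lin_comb (I : finType) (c : I -> R) (X : I -> T -> R) :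
  (forall i, X i \in Lfun P 1) ->
  ('E_P[fun omega => (\sum_i c i * X i omega)%R] =
   \sum_i (c i)%:E * 'E_P[X i])%E.
Proof.
move=> XL; rewrite unlock.
under eq_integral => omega _ do rewrite -sumEFin.
rewrite integral_sum //; last first.
  move=> i; under eq_fun do rewrite EFinM.
  by apply: integrableZl => //; exact/Lfun1_integrable.
apply: eq_bigr => i _; under eq_integral do rewrite EFinM.
by rewrite integralZl //; exact/Lfun1_integrable.
Qed.

End integrability.

(** * Expectations of products of forms *)

Section products_of_forms.
Context (R : realType) (n : nat) d (T : measurableType d) (P : probability T R).
Context (A : {RV P >-> borel_cV R n}) (m : nat).
Context (Am : ('E_P[(fun omega => `|A omega : 'cV[R]_n| ^+ m)%R] < +oo)%E).

Lemma integrable_exp_form (x : 'rV[R]_n) :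
  (fun omega => form x (A omega) ^+ m) \in Lfun P 1.
Proof.
have := integrable_prod_form (fun _ : 'I_m => x) Am.
by under eq_fun do rewrite prodr_const card_ord.
Qed.

Lemma expectation_exp_formZ (c : R) (x : 'rV[R]_n) :
  ('E_P[fun omega => (form (c *: x) (A omega) ^+ m)%R] =
   (c ^+ m)%:E * 'E_P[fun omega => (form x (A omega) ^+ m)%R])%E.
Proof.
rewrite -expectationZl; last exact: integrable_exp_form.
by congr expectation; apply/funext => omega; rewrite formZ exprMn mulrC.
Qed.

Lemma expectation_prod_form_polarization (x : 'I_m -> 'rV[R]_n) :
  ('E_P[fun omega => (\prod_l form (x l) (A omega))%R] =
   \sum_(S : {set 'I_m}) (m`!%:R^-1 * (-1) ^+ #|~: S|%SET)%:E *
     'E_P[fun omega => (form (\sum_(l in S) x l) (A omega) ^+ m)%R])%E.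
Proof.
rewrite -expectation_lin_comb => [|S].
  congr expectation; apply/funext => omega.
  have m0 : m`!%:R != 0 :> R by rewrite pnatr_eq0 -lt0n fact_gt0.
  apply: (mulfI m0); rewrite -polarization mulr_sumr; apply: eq_bigr => S _.
  by rewrite -mulrA mulVKf // form_sum.
exact: integrable_exp_form.
Qed.

Lemma expectation_prod_form_expansion (I : finType) (x : I -> 'rV[R]_n)
    (c : 'I_m -> I -> R) (y : 'I_m -> 'rV[R]_n) :
  (forall l, y l = \sum_i c l i *: x i) ->
  ('E_P[fun omega => (\prod_l form (y l) (A omega))%R] =
   \sum_(f : {ffun 'I_m -> I}) (\prod_l c l (f l))%:E *
     'E_P[fun omega => (\prod_l form (x (f l)) (A omega))%R])%E.
Proof.
move=> yE; rewrite -expectation_lin_comb => [|f]; last first.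
  exact: integrable_prod_form.
congr expectation; apply/funext => omega.
under eq_bigr => l _ do rewrite yE /form mulmx_suml summxE.
rewrite bigA_distr_bigA; apply: eq_bigr => f _; rewrite -big_split /=.
by apply: eq_bigr => l _; exact: formZ.
Qed.

End products_of_forms.

(** * The design rows *)

Section design.
Context (R : realType) (n : nat).

Definition design_row (w : 'cV[R]_n) : 'rV[R]_(1 + n) := row_mx 1%:M w^T.

(** The leading entries 1 add up to j, which is why the average, and not the
    sum, of the points appears. *)
Lemma sum_design_row (j : nat) (w : 'I_j -> 'cV[R]_n) : (0 < j)%N ->
  \sum_l design_row (w l) =
  j%:R *: design_row (j%:R^-1 *: \sum_l w l).
Proof.
move=> j0; have jN0 : j%:R != 0 :> R by rewrite pnatr_eq0 -lt0n.
rewrite /design_row scale_row_mx linearZ /= scalerA mulfV // scale1r.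
apply/rowP => c; rewrite summxE; case: (split_ordP c) => i ->.
  rewrite (eq_bigr (fun=> (1%:M : 'M[R]_1) 0 i)) => [|l _]; last first.
    exact: row_mxEl.
  by rewrite row_mxEl sumr_const card_ord !mxE mulr_natl.
rewrite (eq_bigr (fun l => (w l)^T 0 i)) => [|l _]; last exact: row_mxEr.
rewrite row_mxEr mxE summxE; apply: eq_bigr => l _; exact: mxE.
Qed.

(** A vanishing combination of the design rows has, by its first entry, weights
    of sum zero and, by the other entries, a vanishing combination of the
    points.  So general position makes the square matrix of design rows
    invertible. *)
Lemma general_position_span (w : 'I_n.+1 -> 'cV[R]_n) : general_position w ->
  forall y : 'rV[R]_(1 + n), exists c : 'I_n.+1 -> R,
    y = \sum_i c i *: design_row (w i).
Proof.
move=> gp y; pose M : 'M[R]_(1 + n) := \matrix_i design_row (w i).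
have Munit : M \in unitmx.
  rewrite -row_free_unit; apply: inj_row_free => v.
  rewrite mulmx_sum_row => vM; apply/rowP => i; rewrite [RHS]mxE.
  have vM' : \sum_i v 0 i *: design_row (w i) = 0.
    by rewrite -[RHS]vM; apply: eq_bigr => l _; rewrite rowK.
  apply: (gp (v 0)).
  - apply/colP => l; move/rowP/(_ (rshift 1 l)): vM'.
    rewrite !summxE !mxE => vM'; rewrite -[RHS]vM'.
    by apply: eq_bigr => k _; rewrite [LHS]mxE [RHS]mxE row_mxEr mxE.
  - move/rowP/(_ (lshift n 0)): vM'.
    rewrite !summxE !mxE => vM'; rewrite -[RHS]vM'.
    by apply: eq_bigr => k _; rewrite [RHS]mxE row_mxEl mxE eqxx mulr1.
exists ((y *m invmx M) 0); rewrite -{1}(mulmxKV Munit y) mulmx_sum_row.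
by apply: eq_bigr => i _; rewrite rowK.
Qed.

End design.

(** * Identification *)

Section identification.
Context (R : realType) (n k : nat) (I : finType) (w : I -> 'cV[R]_n).
Context d (T : measurableType d) (P : probability T R)
  (A : {RV P >-> borel_cV R (1 + n)}).
Context d' (T' : measurableType d') (P' : probability T' R)
  (A' : {RV P' >-> borel_cV R (1 + n)}).
Context (Ak : finite_absolute_moments k A) (A'k : finite_absolute_moments k A').
Context (same_moments : forall (j m : nat) (i : 'I_j -> I),
  (1 <= j <= k)%N -> (1 <= m <= k)%N ->
  conditional_moment A m (j%:R^-1 *: \sum_l w (i l)) =
  conditional_moment A' m (j%:R^-1 *: \sum_l w (i l))).

Lemma same_design_product (m : nat) (i : 'I_m -> I) : (m <= k)%N ->
  ('E_P[fun omega => (\prod_l form (design_row (w (i l))) (A omega))%R] =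
   'E_P'[fun omega => (\prod_l form (design_row (w (i l))) (A' omega))%R])%E.
Proof.
move=> mk; rewrite (expectation_prod_form_polarization (Ak mk)).
rewrite (expectation_prod_form_polarization (A'k mk)).
apply: eq_bigr => S _; congr (_ * _)%E.
have [S0|S0] := posnP #|S|.
  (* The empty set gives the constant 0 ^+ m, which is 1 when m = 0. *)
  rewrite (cards0_eq S0) big_set0.
  have form0 (a : 'cV[R]_(1 + n)) : form 0 a ^+ m = 0 ^+ m.
    by rewrite /form mul0mx mxE.
  under [in LHS]eq_fun do rewrite form0; under [in RHS]eq_fun do rewrite form0.
  by rewrite !expectation_cst.
have Sm : (#|S| <= m)%N by rewrite -[X in (_ <= X)%N](card_ord m) max_card.
rewrite big_enum_val sum_design_row //.
rewrite (expectation_exp_formZ (Ak mk)) (expectation_exp_formZ (A'k mk)).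
congr (_ * _)%E; apply: same_moments.
  by rewrite S0 (leq_trans Sm).
by rewrite (leq_trans S0 Sm).
Qed.

(** A monomial is the product of the coordinates read along the list in which
    each index i is repeated [kappa i] times, and a coordinate is the form of a
    standard basis row.  Writing these rows in the design rows reduces the claim
    to products of design forms of the same degree. *)
Lemma same_mixed_moment (kappa : 'I_(1 + n) -> nat) :
  (forall y : 'rV[R]_(1 + n), exists c : I -> R,
     y = \sum_i c i *: design_row (w i)) ->
  (\sum_i kappa i <= k)%N ->
  mixed_moment A kappa = mixed_moment A' kappa.
Proof.
move=> span kappak.
pose s := flatten [seq nseq (kappa i) i | i <- enum 'I_(1 + n)].
have ss : size s = (\sum_i kappa i)%N.
  rewrite size_flatten /shape -map_comp sumnE big_map big_enum /=.
  by apply: eq_bigr => i _; rewrite size_nseq.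
have prodE (a : 'cV[R]_(1 + n)) :
    \prod_i a i 0 ^+ kappa i =
    \prod_(l < size s) form (delta_mx 0 (tnth (in_tuple s) l)) a.
  rewrite -(big_tnth _ _ s xpredT (fun i => form (delta_mx 0 i) a)).
  rewrite big_flatten big_map big_enum /=; apply: eq_bigr => i _.
  by rewrite big_nseq -Monoid.iteropE /form -rowE mxE.
have [c cE] := choice (fun l => span (delta_mx 0 (tnth (in_tuple s) l))).
have sk : (size s <= k)%N by rewrite ss.
rewrite /mixed_moment.
under [in LHS]eq_fun do rewrite prodE.
under [in RHS]eq_fun do rewrite prodE.
rewrite (expectation_prod_form_expansion (Ak sk) cE).
rewrite (expectation_prod_form_expansion (A'k sk) cE).
apply: eq_bigr => f _; congr (_ * _)%E; exact: same_design_product.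
Qed.

End identification.

Theorem theorem6 (R : realType) (p k : nat) (hp : (2 <= p)%N) (hk : (1 <= k)%N)
    (mu : probability (borel_cV R p.-1) R)
    (w : 'I_p -> 'cV[R]_p.-1)
    (hw : general_position w)
    (hsupp : forall i : 'I_p, topological_support mu (w i))
    (havg : forall j : nat, (1 <= j <= k)%N -> forall i : 'I_j -> 'I_p,
      topological_support mu (j%:R^-1 *: \sum_(l < j) w (i l)))
    (kappa : 'I_(1 + p.-1) -> nat)
    (hkappa : (\sum_(i < 1 + p.-1) kappa i <= k)%N) :
  moment_identified mu k kappa.
Proof.
case: p => [//|n] in hp mu w hw hsupp havg kappa hkappa *.
move=> d T P W A d' T' P' W' A' [_ _ Ak] [_ _ A'k] same.
apply: (@same_mixed_moment R n k _ w) => //.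
  by move=> j m i jk mk; apply: same => //; exact: havg.
exact: general_position_span.
Qed.
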